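(* The set of back stable complete homogeneous monomials $\{\overleftarrow{\mathbf h}_\alpha:\alpha\in\mathcal C\}$ forms a $\mathbb Q$-basis of $\mathcal R$.
   Context: $\Lambda^-=\Lambda(\ldots,x_{-1},x_0)$ is the ring of symmetric functions over $\mathbb Q$ in the variables $x_i$, $i\le 0$, and $\mathcal R=\Lambda^-\otimes_{\mathbb Q}\mathbb Q[x_i\mid i\in\mathbb Z]$, identified via multiplication with a ring of bounded-degree formal power series in the variables $x_i$, $i\in\mathbb Z$. For every $k\in\mathbb Z$ and $d\ge 0$ the complete homogeneous symmetric function $\mathbf h_d(\ldots,x_{k-1},x_k)$ in the variables $x_i$, $i\le k$, lies in $\mathcal R$ (with $\mathbf h_0=1$). $\mathcal C$ is the set of finitely supported tuples $\alpha=(\alpha_i)_{i\in\mathbb Z}$ of nonnegative integers, and for $\alpha\in\mathcal C$, $\overleftarrow{\mathbf h}_\alpha=\prod_{i\in\mathbb Z}\mathbf h_{\alpha_i}(\ldots,x_{i-1},x_i)\in\mathcal R$. *)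

(* Defs.v *)
From HB Require Import structures.
From mathcomp Require Import all_boot all_order all_algebra.
From mathcomp Require Import finmap.
From mathcomp Require Import boolp classical_sets cardinality fsbigop.
From mathcomp.multinomials Require Import monalg.
Set Implicit Arguments.
Unset Strict Implicit.
Unset Printing Implicit Defensive.
Import Order.TTheory GRing.Theory Num.Theory.
Local Open Scope classical_set_scope.
Local Open Scope ring_scope.

Record fps (I : choiceType) (K : Type) : Type :=
  Fps { fcoef : {cmonom I} -> K }.

Coercion fcoef : fps >-> Funclass.

HB.instance Definition _ (I K : choiceType) := [isNew for @fcoef I K].
HB.instance Definition _ (I K : choiceType) := [Choice of fps I K by <:].

Section Divisors.
Variable I : choiceType.
Implicit Types a b c m : {cmonom I}.

Lemma divisors_finite m :
  exists D : {fset {cmonom I}}, forall a b, mmul a b = m -> a \in D.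
Proof.
pose T := {ffun finsupp m -> 'I_(mdeg m).+1}.
pose mk (h : T) : {cmonom I} :=
  mkcmonom [fsfun i : finsupp m => nat_of_ord (h i) | 0%N].
exists [fset mk h | h : T]%fset => a b abm.
have ltm i : (a i < (mdeg m).+1)%N.
  rewrite ltnS -abm mdegM; apply: leq_trans (leq_addr _ _).
  rewrite mdegE; case: mdomP => // ai.
  by rewrite (big_fsetD1 _ ai) /= leq_addr.
pose h : T := finfun (fun i : finsupp m => Ordinal (ltm (val i))).
apply/imfsetP; exists h => //.
apply/eqP/cmP => i; rewrite /mk cmE fsfun_ffun.
case: insubP => [u _ <-|]; first by rewrite /= ffunE.
rewrite -cmE_neq0 negbK /= => /eqP; rewrite -{1}abm cmM => /eqP.
by rewrite addn_eq0 => /andP[/eqP].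
Qed.

End Divisors.

Section FpsRing.
Variables (I : choiceType) (K : comNzRingType).
Implicit Types (f g h : fps I K) (m : {cmonom I}) (k : K).

Lemma fpsP f g : (forall m, f m = g m) -> f = g.
Proof. by case: f g => [f] [g] /= fg; congr Fps; apply/funext. Qed.

Let fzero : fps I K := Fps (fun=> 0).
Let fopp f : fps I K := Fps (fun m => - f m).
Let fadd f g : fps I K := Fps (fun m => f m + g m).

Let faddA : associative fadd.
Proof. by move=> f g h; apply/fpsP => m; exact: addrA. Qed.
Let faddC : commutative fadd.
Proof. by move=> f g; apply/fpsP => m; exact: addrC. Qed.
Let fadd0 : left_id fzero fadd.
Proof. by move=> f; apply/fpsP => m; exact: add0r. Qed.
Let faddN : left_inverse fzero fopp fadd.
Proof. by move=> f; apply/fpsP => m; exact: addNr. Qed.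

HB.instance Definition _ :=
  GRing.isZmodule.Build (fps I K) faddA faddC fadd0 faddN.

Definition fps_one : fps I K := Fps (fun m => (m == mone)%:R).

(* A monomial has finitely many factorizations, see [divisors_finite], so the
   sum below is finite. *)
Definition fps_mul f g : fps I K := Fps (fun m =>
  \sum_(p \in [set p : {cmonom I} * {cmonom I} | mmul p.1 p.2 = m])
    f p.1 * g p.2).

Lemma fps_mulE f g m (D : {fset {cmonom I}}) :
    (forall a b, mmul a b = m -> a \in D) ->
  fps_mul f g m =
    \sum_(a <- D) \sum_(b <- D) (if mmul a b == m then f a * g b else 0).
Proof.
move=> mD; pose r := [seq (a, b) | a <- D, b <- D].
have ur : uniq r by apply: allpairs_uniq => // -[? ?] [].
transitivity (\sum_(p <- r | mmul p.1 p.2 == m) f p.1 * g p.2).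
  rewrite bigfs //.
    by apply: eq_fsbigl; apply/seteqP; split=> p /= /eqP.
  move=> [a b] /= /eqP abm /negP[]; apply/allpairsP; exists (a, b).
  by split=> //=; [apply: mD abm | apply: (mD b a); rewrite mulmC].
by rewrite big_mkcond /= big_allpairs.
Qed.

Lemma fps_mulC : commutative fps_mul.
Proof.
move=> f g; apply/fpsP => m; have [D mD] := divisors_finite m.
rewrite !(fps_mulE _ _ mD) exchange_big /=; apply: eq_bigr => a _.
by apply: eq_bigr => b _; rewrite mulmC mulrC.
Qed.

Lemma fps_mul_mulE f g h m (D : {fset {cmonom I}}) :
    (forall a b, mmul a b = m -> a \in D) ->
  fps_mul (fps_mul f g) h m =
    \sum_(a <- D) \sum_(b <- D) \sum_(c <- D)
      (if mmul (mmul a b) c == m then f a * g b * h c else 0).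
Proof.
move=> mD; rewrite (fps_mulE _ _ mD).
transitivity (\sum_(x <- D) \sum_(c <- D) \sum_(a <- D) \sum_(b <- D)
  (if (mmul x c == m) && (mmul a b == x) then f a * g b * h c else 0)).
  apply: eq_bigr => x _; apply: eq_bigr => c _.
  have [xcm|_] := eqVneq; last by rewrite big1 // => a _; rewrite big1.
  rewrite (fps_mulE f g (D := D)); last first.
    by move=> a b abx; apply: (mD a (mmul b c)); rewrite mulmA abx.
  rewrite mulr_suml; apply: eq_bigr => a _; rewrite mulr_suml.
  by apply: eq_bigr => b _ /=; case: ifP => _; rewrite ?mul0r.
under eq_bigr do (rewrite exchange_big /=; under eq_bigr do rewrite exchange_big /=).
rewrite exchange_big /=; apply: eq_bigr => a _.
rewrite exchange_big /=; apply: eq_bigr => b _.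
rewrite exchange_big /=; apply: eq_bigr => c _.
have [abcm|abcm] := eqVneq (mmul (mmul a b) c) m.
  rewrite (big_fsetD1 (mmul a b)) /=; last exact: mD abcm.
  rewrite abcm !eqxx /= big1_seq ?addr0 // => x /=.
  case/fsetD1P => xm _.
  by rewrite [X in _ && X]eq_sym (negPf xm) andbF.
rewrite big1 // => x _; case: ifP => // /andP[/eqP xcm /eqP abx].
by rewrite abx xcm eqxx in abcm.
Qed.

Lemma fps_mulA : associative fps_mul.
Proof.
move=> f g h; rewrite (fps_mulC f); apply/fpsP => m.
have [D mD] := divisors_finite m; rewrite !(fps_mul_mulE _ _ _ mD).
under eq_bigr do rewrite exchange_big /=.
rewrite exchange_big /=; apply: eq_bigr => a _.
apply: eq_bigr => b _; apply: eq_bigr => c _.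
by rewrite mulmC mulmA mulrC mulrA.
Qed.

Lemma fps_mul1l : left_id fps_one fps_mul.
Proof.
move=> f; apply/fpsP => m; have [D mD] := divisors_finite m.
rewrite (fps_mulE _ _ mD) (big_fsetD1 mone) /=; last exact: (mD _ m (mul1m m)).
rewrite [X in _ + X]big1_seq ?addr0 => [|a /=]; last first.
  case/fsetD1P => /negPf a1 _; rewrite big1 // => b _.
  by rewrite a1 mul0r if_same.
rewrite (big_fsetD1 m) /=; last by apply: (mD m mone); rewrite mulm1.
rewrite mul1m !eqxx mul1r big1_seq ?addr0 // => b /=.
by case/fsetD1P => /negPf bm _; rewrite mul1m bm.
Qed.

Lemma fps_mulDl : left_distributive fps_mul +%R.
Proof.
move=> f g h; apply/fpsP => m; have [D mD] := divisors_finite m.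
rewrite (fps_mulE _ _ mD) -[RHS]/(fps_mul f h m + fps_mul g h m).
rewrite !(fps_mulE _ _ mD) -big_split; apply: eq_bigr => a _ /=.
rewrite -big_split; apply: eq_bigr => b _ /=.
by case: ifP => _; rewrite ?addr0 // -mulrDl.
Qed.

Lemma fps_oner_neq0 : fps_one != 0.
Proof.
apply/eqP => /(congr1 (fun f : fps I K => f mone)) /eqP.
by rewrite /= eqxx oner_eq0.
Qed.

HB.instance Definition _ := GRing.Zmodule_isComNzRing.Build (fps I K)
  fps_mulA fps_mulC fps_mul1l fps_mulDl fps_oner_neq0.

Definition fps_scale k f : fps I K := Fps (fun m => k * f m).

Let fscaleA k l f : fps_scale k (fps_scale l f) = fps_scale (k * l) f.
Proof. by apply/fpsP => m; exact: mulrA. Qed.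
Let fscale1 : left_id 1 fps_scale.
Proof. by move=> f; apply/fpsP => m; exact: mul1r. Qed.
Let fscaleDr : right_distributive fps_scale +%R.
Proof. by move=> k f g; apply/fpsP => m; exact: mulrDr. Qed.
Let fscaleDl f : {morph fps_scale^~ f : k l / k + l}.
Proof. by move=> k l; apply/fpsP => m; exact: mulrDl. Qed.

HB.instance Definition _ := GRing.Zmodule_isLmodule.Build K (fps I K)
  fscaleA fscale1 fscaleDr fscaleDl.

Lemma fps_scaleAl k f g : k *: (f * g) = (k *: f) * g.
Proof.
apply/fpsP => m; have [D mD] := divisors_finite m.
rewrite -[LHS]/(k * fps_mul f g m) -[RHS]/(fps_mul (k *: f) g m).
rewrite !(fps_mulE _ _ mD) mulr_sumr; apply: eq_bigr => a _.
rewrite mulr_sumr; apply: eq_bigr => b _.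
by case: ifP => _; rewrite ?mulr0 // mulrA.
Qed.

HB.instance Definition _ :=
  GRing.Lmodule_isLalgebra.Build K (fps I K) fps_scaleAl.
HB.instance Definition _ := GRing.Lalgebra_isComAlgebra.Build K (fps I K).

Definition fps_of_poly (p : {malg K[{cmonom I}]}) : fps I K :=
  Fps (fun m => p@_m).

End FpsRing.

(* Lambda^-: symmetric functions in the variables x_i, i <= 0. *)
Definition Lambda_minus : set (fps int rat) := [set f |
  [/\ exists n : nat, forall m, f m != 0 -> (mdeg m <= n)%N,
      forall m, f m != 0 -> forall i : int, 0 < i -> m i = 0%N
    & forall s : int -> int, bijective s -> (forall i, 0 < i -> s i = i) ->
      forall m m' : {cmonom int}, (forall i, m' i = m (s i)) -> f m' = f m]].

(* The image of the multiplication map from Lambda^- (x) Q[x_i | i in Z]. *)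
Definition backstable_ring : set (fps int rat) := [set f |
  exists (n : nat) (g : 'I_n -> fps int rat)
         (p : 'I_n -> {malg rat[{cmonom int}]}),
    (forall j, Lambda_minus (g j)) /\ f = \sum_j g j * fps_of_poly (p j)].

(* h_d(..., x_(k-1), x_k) is the sum of all monomials of degree d in the
   variables x_i, i <= k. *)
Definition complete_sym (k : int) (d : nat) : fps int rat := Fps (fun m =>
  ((mdeg m == d) && all (fun i : int => i <= k) (finsupp m))%:R).

Lemma complete_sym0 k : complete_sym k 0 = 1.
Proof.
apply/fpsP => m /=; rewrite mdeg_eq0; have [->|//] := eqVneq m mone.
by rewrite mdom1.
Qed.

Definition compositions : Type := {fsfun of _ : int => 0%N}.
HB.instance Definition _ := Choice.on compositions.

(* Factors with alpha_i = 0 are h_0 = 1, so the product over Z reduces to the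
   support of alpha. *)
Definition backstable_h (alpha : compositions) : fps int rat :=
  \prod_(i <- finsupp alpha) complete_sym i (alpha i).

Definition family_basis (K : nzRingType) (V : lmodType K) (A : choiceType)
    (S : set V) (b : A -> V) : Prop :=
  [/\ forall a, S (b a),
      forall (F : {fset A}) (c : A -> K),
        \sum_(a <- F) c a *: b a = 0 -> forall a, a \in F -> c a = 0
    & forall v, S v -> exists (F : {fset A}) (c : A -> K),
        v = \sum_(a <- F) c a *: b a].

(* Main.v *)
(* Independence: order monomials by dominance of their tail degrees
   [\sum_(j >= t) m_j]; then [h_alpha] is [x^alpha] plus strictly dominated
   monomials.

   Spanning: write h_d(k) for [complete_sym k d].  From
   h_(d+1)(k) = h_(d+1)(k-1) + x_k h_d(k) one eliminates x_k to get
     h_a(k) h_(b+1)(k) = h_a(k) h_(b+1)(k-1) + h_(a+1)(k) h_b(k)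
                         - h_(a+1)(k-1) h_b(k),
   and induction on b moves one of two factors with the same index k to index
   k-1.  Hence the span of the h_alpha is a ring.  It contains
   x_k = h_1(k) - h_1(k-1), and the power sums p_r of the variables x_i, i <= 0,
   by Newton's identities.  For a symmetric f of degree d, the operator
   x_t d/dx_t sends f to \sum_r x_t^r F_r with symmetric F_r of degree d-r not
   depending on t; summing over t, Euler's identity becomes
   d f = \sum_r p_r F_r, and f lies in the span by induction on d. *)
Require Import Defs.
From mathcomp Require Import all_boot all_order all_algebra.
From mathcomp Require Import finmap boolp classical_sets zify ring.
From mathcomp.multinomials Require Import monalg.

Set Implicit Arguments.
Unset Strict Implicit.
Unset Printing Implicit Defensive.
Import Order.TTheory GRing.Theory Num.Theory.
Local Open Scope ring_scope.

(** * Spans and power series *)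

Section Span.
Context (K : nzRingType) (V : lmodType K).
Implicit Types (X Y : set V) (u v : V).

(** Adding one generator at a time turns every linear extension argument into an induction, with no
    index sets to carry. *)
Inductive span X : V -> Prop :=
| Span0 : span X 0
| SpanD a x v : X x -> span X v -> span X (a *: x + v).

Lemma span_mem X v : X v -> span X v.
Proof. by move=> Xv; rewrite -[v]scale1r -[_ *: _]addr0; do !constructor. Qed.

Lemma spanD X u v : span X u -> span X v -> span X (u + v).
Proof.
move=> Xu Xv; elim: Xu => [|a x w Xx _ IH]; first by rewrite add0r.
by rewrite -addrA; constructor.
Qed.

Lemma spanZ X a v : span X v -> span X (a *: v).
Proof.
elim=> [|b x w Xx _ IH]; first by rewrite scaler0; constructor.
by rewrite scalerDr scalerA; constructor.
Qed.

Lemma spanN X v : span X v -> span X (- v).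
Proof. by move=> Xv; rewrite -scaleN1r; apply: spanZ. Qed.

Lemma spanB X u v : span X u -> span X v -> span X (u - v).
Proof. by move=> Xu Xv; apply: spanD => //; apply: spanN. Qed.

Lemma span_sum X (I : Type) (r : seq I) (P : pred I) (F : I -> V) :
  (forall i, P i -> span X (F i)) -> span X (\sum_(i <- r | P i) F i).
Proof. by move=> XF; elim/big_rec: _ => [|i v /XF]; [constructor | exact: spanD]. Qed.

Lemma span_sub X Y v : (forall x, X x -> span Y x) -> span X v -> span Y v.
Proof.
move=> XY; elim=> [|a x w /XY Yx _]; [by constructor | exact/spanD/spanZ].
Qed.

Lemma span_range_fset (A : choiceType) (b : A -> V) v : span (range b) v ->
  exists (F : {fset A}) (c : A -> K), v = \sum_(a <- F) c a *: b a.
Proof.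
elim=> [|k _ w [a _ <-] _ [F [c ->]]].
  by exists fset0, (fun=> 0); rewrite big_seq_fset0.
(* [c] is arbitrary outside [F], so it is cut off there before [a] is adjoined. If [a] already lies
   in [F], its two coefficients add. *)
pose c0 x := if x \in F then c x else 0.
exists (a |` F)%fset, (fun x => (if x == a then k else 0) + c0 x).
under [RHS]eq_bigr do rewrite scalerDl.
rewrite big_split /=; congr (_ + _).
  rewrite (big_fsetD1 a) ?fset1U1 //= eqxx big1_seq ?addr0 // => x /=.
  by case/fsetD1P => /negPf->; rewrite scale0r.
transitivity (\sum_(x <- F) c0 x *: b x).
  by apply: eq_big_seq => x xF; rewrite /c0 xF.
apply: big_fset_incl => [|x _ /negPf xF]; first exact: fsubsetUr.
by rewrite /c0 xF scale0r.
Qed.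

End Span.

Section SpanAlg.
Context (K : comNzRingType) (V : comAlgType K).
Implicit Types (X Y Z : set V) (u v : V).

(** Multiplication by [u] is linear, so generators suffice. [X] and [Y] may differ because
    straightening changes the bound on the indices. *)
Lemma spanMl X Y u v :
  (forall x, X x -> span Y (u * x)) -> span X v -> span Y (u * v).
Proof.
move=> XY; elim=> [|a x w /XY Yx _ IH]; first by rewrite mulr0; constructor.
by rewrite mulrDr -scalerAr; apply/spanD/IH/spanZ.
Qed.

Lemma spanM X u v : (forall x y, X x -> X y -> span X (x * y)) ->
  span X u -> span X v -> span X (u * v).
Proof.
move=> XM Xu; apply: spanMl => x Xx; rewrite mulrC.
by move: Xu; apply: spanMl => y; exact: XM.
Qed.

End SpanAlg.

(** * Monomials, their quotients, and coefficients of products *)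

Section Monomials.
Context (I : choiceType).
Implicit Types (m a b : {cmonom I}) (i j : I).

Definition cmonomX i n : {cmonom I} := [cmonom n | _ in fset1 i]%M.

Lemma cmonomXE i n j : cmonomX i n j = if i == j then n else 0%N.
Proof. by rewrite cmE fsfun_fun in_fsetE; case: eqVneq. Qed.

Lemma mem_cmonomX i j n :
  (j \in finsupp (cmonomX i n)) = (0 < n)%N && (j == i).
Proof.
rewrite -cmE_neq0 cmonomXE -lt0n; case: (eqVneq j i) => _.
  by rewrite andbT.
by rewrite andbF.
Qed.

Lemma cmonomX_inj n : (0 < n)%N ->
  injective (cmonomX^~ n).
Proof.
move=> n0 i j /=/(congr1 (fun m : {cmonom I} => i \in finsupp m)).
by rewrite !mem_cmonomX n0 eqxx => /esym/eqP.
Qed.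

Lemma mulcmK a b : divcm (mmul a b) a = b.
Proof. by apply/eqP/cmP => i; rewrite divcmE cmM addKn. Qed.

Lemma divcmK m i n : (n <= m i)%N -> mmul (cmonomX i n) (divcm m (cmonomX i n)) = m.
Proof.
move=> nm; apply/eqP/cmP => j; rewrite cmM divcmE cmonomXE.
by case: eqVneq => [<-|_]; rewrite ?subnKC // subn0.
Qed.

Lemma divcmK_le m i n :
  (mmul (cmonomX i n) (divcm m (cmonomX i n)) == m) = (n <= m i)%N.
Proof.
apply/eqP/idP => [<-|]; last exact: divcmK.
by rewrite cmM cmonomXE eqxx leq_addr.
Qed.

Lemma mdeg_cmonomX i n : mdeg (cmonomX i n) = n.
Proof.
have le : (finsupp (cmonomX i n) `<=` [fset i])%fset.
  by apply/fsubsetP => j; rewrite mem_cmonomX in_fset1 => /andP[].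
by rewrite (mdegEw le) big_seq_fset1 cmonomXE eqxx.
Qed.

Lemma mdeg_divcm m i n : (n <= m i)%N ->
  mdeg m = (n + mdeg (divcm m (cmonomX i n)))%N.
Proof. by move=> /divcmK {1}<-; rewrite mdegM mdeg_cmonomX. Qed.

Lemma leq_mdeg m i : (m i <= mdeg m)%N.
Proof. by rewrite (@mdeg_divcm m i (m i)) // leq_addr. Qed.

Lemma mdeg_neq0 m : m != mone -> exists i, (0 < m i)%N.
Proof.
move=> m1; apply: contrapT => m0; case/eqP: m1; apply/eqP/cmP => i.
rewrite cm1; apply/eqP; rewrite -leqn0 leqNgt; apply/negP => mi.
by apply: m0; exists i.
Qed.

End Monomials.

Section PowerSeries.
Context (I : choiceType) (K : comNzRingType).
Implicit Types (f g : fps I K) (m u : {cmonom I}).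

Lemma fcoefD f g m : (f + g) m = f m + g m. Proof. by []. Qed.
Lemma fcoefZ k f m : (k *: f) m = k * f m. Proof. by []. Qed.
Lemma fcoef0 m : (0 : fps I K) m = 0. Proof. by []. Qed.
Lemma fcoef1 m : (1 : fps I K) m = (m == mone)%:R. Proof. by []. Qed.

Lemma fcoef_sum (J : Type) (r : seq J) (P : pred J) (F : J -> fps I K) m :
  (\sum_(j <- r | P j) F j) m = \sum_(j <- r | P j) F j m.
Proof. exact: (big_morph (fun f => f m) (fun f g => fcoefD f g m) (fcoef0 m)). Qed.

(** A left factor [a] forces the right one to be [divcm m a]. This quotient is truncated, so the
    filter tests divisibility. [D] only has to contain the left factors that contribute. *)
Lemma fcoefM f g m (D : {fset {cmonom I}}) :
    (forall a b, mmul a b = m -> f a * g b != 0 -> a \in D) ->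
  (f * g) m =
    \sum_(a <- D | mmul a (divcm m a) == m) f a * g (divcm m a).
Proof.
move=> mD; have [D0 mD0] := divisors_finite m.
pose G a := if mmul a (divcm m a) == m then f a * g (divcm m a) else 0.
transitivity (\sum_(a <- D0) G a).
  rewrite -[LHS]/(fps_mul f g m) (fps_mulE _ _ mD0).
  apply: eq_bigr => a _; rewrite /G.
  case: (eqVneq (mmul a (divcm m a)) m) => [E|nE].
    rewrite (big_fsetD1 (divcm m a)) /=; last by apply: (mD0 _ a); rewrite mulmC.
    rewrite E eqxx big1_seq ?addr0 // => b /fsetD1P[/eqP nb _].
    by case: eqP => // abm; case: nb; rewrite -abm mulcmK.
  rewrite big1 // => b _; case: eqP => // abm; case/eqP: nE.
  by rewrite -[in divcm _ _]abm mulcmK.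
(* Both sums are compared on the union of [D0] and [D], where the additional terms vanish. *)
rewrite [RHS]big_mkcond /= (big_fset_incl _ (fsubsetUl D0 D)); last first.
  move=> a _ aD0; rewrite /G; case: eqP => // /mD0 aD0'.
  by rewrite aD0' in aD0.
rewrite [RHS](big_fset_incl _ (fsubsetUr D0 D)) // => a _ /negP aD.
by case: eqP => // /mD aD'; apply/eqP; apply: contra_notT aD.
Qed.

Lemma fcoefM_neq0 f g m : (f * g) m != 0 ->
  exists a b, [/\ mmul a b = m, f a != 0 & g b != 0].
Proof.
apply: contraNP => nex; rewrite (@fcoefM _ _ _ fset0).
  by rewrite big_mkcond big_seq_fset0.
move=> a b ab fg; case: nex; exists a, b; split=> //; apply: contraNneq fg => ->.
  by rewrite mul0r.
by rewrite mulr0.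
Qed.

Definition fps_monom u : fps I K := Fps (fun m => (m == u)%:R).

Lemma fcoef_monomM u f m : (fps_monom u * f) m =
  if mmul u (divcm m u) == m then f (divcm m u) else 0.
Proof.
rewrite (@fcoefM _ _ _ [fset u]%fset) => [|a b _ /=].
  by rewrite big_mkcond big_seq_fset1 /= eqxx mul1r.
rewrite in_fset1; case: (a =P u) => [_ _|_].
  by [].
by rewrite mul0r eqxx.
Qed.

Lemma fps_monomM u v : fps_monom (mmul u v) = fps_monom u * fps_monom v.
Proof.
apply/fpsP => m; rewrite fcoef_monomM /=.
case: eqVneq => [->|nm]; first by rewrite mulcmK !eqxx.
case: eqP => // muv; case: eqP => // E; case/eqP: nm.
by rewrite -muv E.
Qed.

Lemma fps_monom1 : fps_monom mone = 1.
Proof. by apply/fpsP. Qed.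

Lemma fps_of_polyE (p : {malg K[{cmonom I}]}) :
  fps_of_poly p = \sum_(m <- msupp p) p@_m *: fps_monom m.
Proof.
apply/fpsP => m; rewrite fcoef_sum /=.
case: msuppP => mp.
  rewrite (big_fsetD1 m) //= eqxx mulr1 big1_seq ?addr0 // => u.
  by case/fsetD1P=> um _; rewrite eq_sym (negPf um) mulr0.
rewrite big1_seq // => u /= up; case: eqP => [mu|_]; last by rewrite mulr0.
by rewrite mu up in mp.
Qed.

End PowerSeries.

(** * Linear independence *)

Section Dominance.
Implicit Types (m a b u v : {cmonom int}) (i j t : int).

Definition tail_deg t m : nat := \sum_(j <- finsupp m | (t <= j)%R) m j.

Lemma tail_degEw t m (D : {fset int}) : (finsupp m `<=` D)%fset ->
  tail_deg t m = (\sum_(j <- D | (t <= j)%R) m j)%N.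
Proof.
move=> mD; rewrite /tail_deg big_mkcond [RHS]big_mkcond.
apply: big_fset_incl => // j _; rewrite -cmE_eq0 => /eqP->.
by rewrite if_same.
Qed.

Lemma tail_degM t a b : tail_deg t (mmul a b) = (tail_deg t a + tail_deg t b)%N.
Proof.
rewrite (@tail_degEw _ a (finsupp (mmul a b))) ?mdomD ?fsubsetUl //.
rewrite (@tail_degEw _ b (finsupp (mmul a b))) ?mdomD ?fsubsetUr //.
by rewrite -mdomD -big_split; apply: eq_bigr => j _; rewrite cmM.
Qed.

Lemma tail_degS t m : tail_deg t m = (m t + tail_deg (t + 1) m)%N.
Proof.
pose D := (t |` finsupp m)%fset.
have mD : (finsupp m `<=` D)%fset by exact: fsubsetUr.
have tD : t \in D by rewrite fset1U1.
rewrite !(tail_degEw _ mD) big_mkcond [in RHS]big_mkcond /=.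
rewrite (big_fsetD1 _ tD) [in RHS](big_fsetD1 _ tD) /= lexx ifN; last by lia.
rewrite add0n; congr (_ + _)%N; apply: eq_big_seq => j /fsetD1P[jt _].
by congr (if _ then _ else _); lia.
Qed.

Lemma tail_deg_le t m : (tail_deg t m <= mdeg m)%N.
Proof.
rewrite /tail_deg big_mkcond mdegE; apply: leq_sum => j _.
by case: ifP.
Qed.

Definition dominated a b := forall t, (tail_deg t a <= tail_deg t b)%N.

Lemma dominated_trans b a c : dominated a b -> dominated b c -> dominated a c.
Proof. by move=> ab bc t; exact: leq_trans (ab t) (bc t). Qed.

(** The exponent at [t] is the difference of the tail degrees at [t] and [t + 1], so tail degrees
    determine the monomial. *)
Lemma dominated_anti a b : dominated a b -> dominated b a -> a = b.
Proof.
move=> ab ba; have E t : tail_deg t a = tail_deg t b.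
  by apply/eqP; rewrite eqn_leq ab ba.
apply/eqP/cmP => t; have := E t; rewrite tail_degS [in RHS]tail_degS E.
exact: addIn.
Qed.

Definition top_monom (f : fps int rat) u :=
  f u = 1 /\ forall m, f m != 0 -> dominated m u.

Lemma top_monom1 : top_monom 1 mone.
Proof.
split=> [|m]; rewrite fcoef1 ?eqxx //; case: (m =P mone) => [-> _ t //|_].
by rewrite eqxx.
Qed.

(** Tail degrees add under products, so only the factorization of [mmul u v] into [u] and [v]
    contributes to its coefficient. *)
Lemma top_monomM f g u v :
  top_monom f u -> top_monom g v -> top_monom (f * g) (mmul u v).
Proof.
move=> [fu fD] [gv gD]; split=> [|m].
  rewrite (@fcoefM _ _ _ _ _ [fset u]%fset) => [|a b ab fg].
    by rewrite big_mkcond big_seq_fset1 /= mulcmK eqxx fu gv mulr1.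
  rewrite in_fset1; apply/eqP.
  have fa : f a != 0 by apply: contraNneq fg => ->; rewrite mul0r.
  have gb : g b != 0 by apply: contraNneq fg => ->; rewrite mulr0.
  (* Since [b] is dominated by [v] and [mmul a b = mmul u v], additivity makes [u] dominated by
     [a]. *)
  apply: (dominated_anti (fD _ fa)) => t.
  have := congr1 (tail_deg t) ab; rewrite !tail_degM => E.
  by rewrite -(leq_add2r (tail_deg t v)) -E leq_add2l (gD _ gb).
case/fcoefM_neq0=> a [b [<- /fD au /gD bv]] t.
by rewrite !tail_degM leq_add.
Qed.

Lemma complete_symP k d m : complete_sym k d m != 0 ->
  mdeg m = d /\ forall i, k < i -> m i = 0%N.
Proof.
rewrite /= pnatr_eq0 eqb0 negbK => /andP[/eqP md /allP mk]; split=> // i ki.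
by apply/eqP; rewrite cmE_eq0; apply/negP => /mk; rewrite leNgt ki.
Qed.

Lemma complete_symE k d m : mdeg m = d -> (forall i, k < i -> m i = 0%N) ->
  complete_sym k d m = 1.
Proof.
move=> md mk /=; rewrite md eqxx /=.
suff -> : all (<= k) (finsupp m) by [].
apply/allP => i; rewrite -cmE_neq0; case: (leP i k) => // /mk->.
by rewrite eqxx.
Qed.

(** $x_k^d$ puts the whole degree at the largest allowed index: its tail degree is [d] up to [k],
    and beyond [k] every monomial of the series has tail degree 0. *)
Lemma top_complete_sym k d : top_monom (complete_sym k d) (cmonomX k d).
Proof.
split=> [|m /complete_symP[md mk] t].
  by apply: complete_symE => [|i ki]; rewrite ?mdeg_cmonomX // cmonomXE; case: eqP; lia.
have [tk|kt] := leP t k; last first.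
  rewrite /tail_deg big1 // => j tj; apply: mk; exact: lt_le_trans kt tj.
have -> : tail_deg t (cmonomX k d) = d; last by rewrite -md tail_deg_le.
rewrite (@tail_degEw _ _ [fset k]%fset).
  by rewrite big_mkcond big_seq_fset1 tk cmonomXE eqxx.
by apply/fsubsetP => j; rewrite mem_cmonomX in_fset1 => /andP[].
Qed.

Lemma top_backstable_h (alpha : compositions) :
  top_monom (backstable_h alpha) (mkcmonom alpha).
Proof.
suff -> : mkcmonom alpha =
    \big[mmul/mone]_(i <- finsupp alpha) cmonomX i (alpha i).
  by rewrite /backstable_h; elim/big_rec2: _ => [|i u f _];
    [exact: top_monom1 | exact/top_monomM/top_complete_sym].
apply/eqP/cmP => j; rewrite (big_morph (fun m => m j) (cmM j) (cm1 j)) cmE /=.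
have [aj|aj] := boolP (j \in finsupp alpha).
  rewrite (big_fsetD1 j) //= cmonomXE eqxx big1_seq ?addn0 // => i /=.
  by case/fsetD1P => ij _; rewrite cmonomXE (negPf ij).
rewrite fsfun_dflt // big1_seq // => i /= ai; rewrite cmonomXE.
by case: eqP => // ij; rewrite -ij ai in aj.
Qed.

End Dominance.

(** Dominance is only a partial order, so a maximal element replaces a maximum in the independence
    argument. *)
Lemma exists_maximal (T : eqType) (r : T -> T -> Prop) (s : seq T) :
    (forall x, r x x) -> (forall y x z, r x y -> r y z -> r x z) ->
    (forall x y, r x y -> r y x -> x = y) ->
  s != [::] -> exists2 x, x \in s & forall y, y \in s -> r x y -> y = x.
Proof.
move=> r_refl r_trans r_anti; elim: s => // x s IH _.
have [->|/IH[M sM maxM]] := eqVneq s [::].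
  by exists x => [|y]; rewrite inE // => /eqP.
have [rMx|rMx] := pselect (r M x).
  exists x => [|y]; rewrite inE ?eqxx // => /predU1P[//|sy] rxy.
  have yM : y = M by apply: maxM => //; exact: r_trans rMx rxy.
  by rewrite yM in rxy *; exact: r_anti.
exists M => [|y]; rewrite inE ?sM ?orbT // => /predU1P[-> /rMx//|].
exact: maxM.
Qed.

Lemma backstable_h_free (F : {fset compositions}) (c : compositions -> rat) :
  \sum_(a <- F) c a *: backstable_h a = 0 -> forall a, a \in F -> c a = 0.
Proof.
move=> sum0 a0 a0F; apply: contrapT => /eqP c0.
pose r (a b : compositions) := dominated (mkcmonom a) (mkcmonom b).
pose s := [seq a <- F | c a != 0].
have [||||a] := @exists_maximal _ r s.
- by move=> x t.
- by move=> y x z; exact: dominated_trans.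
- move=> x y xy yx; have E := dominated_anti xy yx.
  by apply/fsfunP => i; have := cmE x i; rewrite E cmE.
- by apply: contraTneq isT => s0; have : a0 \in s by [rewrite mem_filter c0]; rewrite s0.
rewrite mem_filter => /andP[ca aF] maxa; case/eqP: ca.
(* In the coefficient of $x^a$, any other contributing [b] with [c b != 0] would dominate [a],
   against maximality; only [c a] remains. *)
move/(congr1 (fun f : fps int rat => f (mkcmonom a))): sum0.
rewrite fcoef_sum (big_fsetD1 a) // fcoefZ (proj1 (top_backstable_h a)) mulr1.
rewrite big1_seq /= => [|b /fsetD1P[ba bF]]; first by rewrite addr0.
have [->|cb] := eqVneq (c b) 0; first by rewrite mul0r.
have [->|hb] := eqVneq (backstable_h b (mkcmonom a)) 0; first by rewrite mulr0.
case/eqP: ba; apply: maxa; first by rewrite mem_filter cb.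
exact: (proj2 (top_backstable_h b)).
Qed.

(** * Straightening products *)

Definition X_ (i : int) : fps int rat := fps_monom rat (cmonomX i 1).

Lemma complete_symS k d :
  complete_sym k d.+1 = complete_sym (k - 1) d.+1 + X_ k * complete_sym k d.
Proof.
apply/fpsP => m; rewrite fcoefD /X_ fcoef_monomM divcmK_le.
(* If $x_k$ does not divide [m], the product contributes nothing; otherwise the series of index
   [k - 1] contributes nothing. *)
have [mk|] := posnP (m k).
  rewrite addr0 /=; congr ((_ && _)%:R).
  apply/allP/allP => le i mi; have := le i mi; last by lia.
  by rewrite le_eqVlt => /predU1P[ik|]; [rewrite -cmE_neq0 ik mk in mi | lia].
move=> mk; have mk' : k \in finsupp m by rewrite -cmE_neq0 -lt0n.
rewrite /= (mdeg_divcm mk) eqSS.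
have -> : all (fun i : int => i <= k - 1) (finsupp m) = false.
  by apply/negP => /allP/(_ _ mk'); lia.
rewrite andbF add0r; congr ((_ && _)%:R).
apply/allP/allP => le i mi; have [->//|ik] := eqVneq i k; apply: le.
  by move: mi; rewrite -!cmE_neq0 divcmE; case: (m i).
by move: mi; rewrite -!cmE_neq0 divcmE cmonomXE [k == i]eq_sym (negPf ik) subn0.
Qed.

(** Applying the recursion to both factors cancels $x_k h_a(k) h_b(k)$. Each term on the right has a
    single factor of index [k], or a second factor of smaller degree. *)
Lemma complete_symMS k a b :
  complete_sym k a * complete_sym k b.+1 =
    complete_sym k a * complete_sym (k - 1) b.+1 +
    complete_sym k a.+1 * complete_sym k b -
    complete_sym (k - 1) a.+1 * complete_sym k b.
Proof. rewrite (complete_symS k a) (complete_symS k b); ring. Qed.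

Lemma X_E k : X_ k = complete_sym k 1 - complete_sym (k - 1) 1.
Proof. by rewrite (complete_symS k 0) complete_sym0 mulr1 addrC addKr. Qed.

Implicit Types (alpha : compositions) (k : int).

Definition upd alpha k d : compositions := [fsfun alpha with k |-> d].

Lemma updE alpha k d i : upd alpha k d i = if i == k then d else alpha i.
Proof. exact: fsfun_withE. Qed.

Lemma backstable_hEw alpha (D : {fset int}) : (finsupp alpha `<=` D)%fset ->
  backstable_h alpha = \prod_(i <- D) complete_sym i (alpha i).
Proof.
move=> aD; apply: big_fset_incl => // i _ ia.
by rewrite fsfun_dflt // complete_sym0.
Qed.

Lemma backstable_hD1 alpha k :
  backstable_h alpha = complete_sym k (alpha k) * backstable_h (upd alpha k 0).
Proof.
pose D := (k |` finsupp alpha)%fset.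
rewrite !(@backstable_hEw _ D) ?fsubsetUr //.
  have kD : k \in D by rewrite fset1U1.
  rewrite (big_fsetD1 _ kD) [in RHS](big_fsetD1 _ kD) /=.
  rewrite updE eqxx complete_sym0 mul1r.
  congr (_ * _); apply: eq_big_seq => i /fsetD1P[ik _].
  by rewrite updE (negPf ik).
apply/fsubsetP => i; rewrite !inE !mem_finsupp updE.
by case: (eqVneq i k) => [|_ ->]; rewrite ?orbT.
Qed.

Definition supp_le k alpha := forall i, k < i -> alpha i = 0%N.

Lemma supp_le_upd k alpha : supp_le k alpha -> supp_le (k - 1) (upd alpha k 0).
Proof. by move=> ka i ki; rewrite updE; case: eqP => // ik; apply: ka; lia. Qed.

Lemma supp_le_bound k alpha : exists n : nat, supp_le (k + n%:Z) alpha.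
Proof.
exists (\sum_(j <- finsupp alpha) `|j - k|)%N => i ki.
apply/eqP; rewrite -[_ == _]negbK -mem_finsupp; apply/negP => ai.
by move: ki; rewrite (big_fsetD1 i) //=; lia.
Qed.

(** This filtration of [hspan] by greatest index records that slot [k] is still empty at level
    [k - 1], so a factor of index [k] can be placed there. *)
Definition hspan_le k := span [set backstable_h alpha | alpha in supp_le k].
Definition hspan := span (range backstable_h).

Lemma hspan_leM k d f :
  hspan_le (k - 1) f -> hspan_le k (complete_sym k d * f).
Proof.
apply: spanMl => _ [alpha ka <-]; apply: span_mem.
exists (upd alpha k d) => [i ki|].
  by rewrite updE; case: eqP => [ik|_]; [lia | apply: ka; lia].
rewrite (backstable_hD1 _ k) updE eqxx; congr (_ * backstable_h _).
apply/fsfunP => i; rewrite !updE; case: (eqVneq i k) => [->|//].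
by rewrite ka //; lia.
Qed.

Lemma hspan_leM2 k a b f :
    (forall d, hspan_le (k - 1) (complete_sym (k - 1) d * f)) ->
  hspan_le k (complete_sym k a * (complete_sym k b * f)).
Proof.
move=> kf; elim: b a => [|b IH] a.
  (* For [b = 0] the second factor is 1, and [f] itself is $h_0(k-1) f$, the case [d = 0] of the
     hypothesis. *)
  rewrite complete_sym0 mul1r; apply: hspan_leM.
  by rewrite -[f]mul1r -(complete_sym0 (k - 1)).
rewrite mulrA complete_symMS mulrBl mulrDl -!mulrA.
apply: spanB; first by apply: spanD; [exact: hspan_leM | exact: IH].
by rewrite mulrCA; exact: hspan_leM.
Qed.

(** Induction on the size of the support: when slot [k] is occupied, one of the two colliding
    factors moves to index [k - 1], where it meets [alpha] with slot [k] cleared. *)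
Lemma hspan_le_insert k d alpha : supp_le k alpha ->
  hspan_le k (complete_sym k d * backstable_h alpha).
Proof.
elim: {alpha}_.+1 {-2}alpha k d (ltnSn #|` finsupp alpha|) => // n IH alpha k d.
move=> an ka; have ka' := supp_le_upd ka.
rewrite (backstable_hD1 _ k).
have [ak|ak] := posnP (alpha k).
  rewrite ak complete_sym0 mul1r; apply: hspan_leM; apply: span_mem.
  by exists (upd alpha k 0).
apply: hspan_leM2 => b; apply: IH => //.
rewrite ltnS in an; apply: leq_trans an; apply: fproper_ltn_card.
by rewrite finsupp_with eqxx; apply: fproperD1; rewrite mem_finsupp -lt0n.
Qed.

Lemma hspan_sym k d f : hspan f -> hspan (complete_sym k d * f).
Proof.
apply: spanMl => _ [alpha _ <-]; have [n an] := supp_le_bound k alpha.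
suff : hspan_le (k + n%:Z) (complete_sym k d * backstable_h alpha).
  by apply: span_sub => _ [beta _ <-]; apply: span_mem; exists beta.
(* Factors of index above [k] are peeled off from the top; after the insertion below, [hspan_leM]
   puts each one back. *)
elim: n alpha an => [|n IH] alpha an.
  by rewrite addr0 in an *; exact: hspan_le_insert.
have kn : k + n.+1%:Z - 1 = k + n%:Z by lia.
rewrite (backstable_hD1 _ (k + n.+1%:Z)) mulrCA; apply: hspan_leM.
by rewrite kn; apply: IH; rewrite -kn; exact: supp_le_upd.
Qed.

Lemma hspanM f g : hspan f -> hspan g -> hspan (f * g).
Proof.
apply: spanM => _ g' [alpha _ <-] [beta _ <-].
rewrite [backstable_h alpha]/backstable_h.
elim/big_rec: _ => [|i v _ IH]; last by rewrite -mulrA; exact: hspan_sym.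
by rewrite mul1r; apply: span_mem; exists beta.
Qed.

Lemma hspan1 : hspan 1.
Proof.
apply: span_mem; exists [fsfun for fun=> 0%N] => //.
by rewrite /backstable_h finsupp0 big_seq_fset0.
Qed.

Lemma hspan_complete_sym k d : hspan (complete_sym k d).
Proof. by rewrite -[complete_sym k d]mulr1; apply/hspan_sym/hspan1. Qed.

Lemma hspan_monom (m : {cmonom int}) : hspan (fps_monom rat m).
Proof.
have [n] := ubnP (mdeg m); elim: n m => // n IH m mn.
have [->|/mdeg_neq0[i mi]] := eqVneq m mone.
  by rewrite fps_monom1; exact: hspan1.
rewrite -(divcmK mi) fps_monomM; apply: hspanM.
  by rewrite -/(X_ i) X_E; apply: spanB; exact: hspan_complete_sym.
by apply: IH; move: mn; rewrite (mdeg_divcm mi).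
Qed.

(** * Symmetric functions *)

Implicit Types (f g : fps int rat) (m : {cmonom int}) (i j t : int).

(** The power sum $p_r$ in the variables $x_i$, $i \le 0$. Searching for [i] in the finite support
    of [m] keeps the coefficient boolean; for [r = 0] the series is 0. *)
Definition pow_sum r : fps int rat := Fps (fun m =>
  (has (fun i : int => (i <= 0) && (m == cmonomX i r)) (finsupp m))%:R).

Lemma pow_sum_cmonomX r i : (0 < r)%N -> pow_sum r (cmonomX i r) = (i <= 0)%R%:R.
Proof.
move=> r0 /=; congr ((_ : bool)%:R); apply/hasP/idP => [[j _ /andP[j0 /eqP]]|i0].
  by move/(cmonomX_inj r0) => ->.
by exists i; rewrite ?i0 ?eqxx // mem_cmonomX r0 eqxx.
Qed.

(** For positive [r] the powers $x_i^r$ are distinct, so the relevant left factors are indexed by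
    the finitely many variables of [m]. *)
Lemma fcoef_pow_sumM r f m : (0 < r)%N -> (pow_sum r * f) m =
  \sum_(i <- finsupp m | (i <= 0) && (r <= m i)%N) f (divcm m (cmonomX i r)).
Proof.
move=> r0; pose D := [fset cmonomX i r | i in finsupp m]%fset.
rewrite (@fcoefM _ _ _ _ _ D) => [|a b abm pf].
  rewrite big_mkcond big_imfset => [|i j _ _]; last exact: cmonomX_inj.
  rewrite [RHS]big_mkcond; apply: eq_bigr => i _.
  rewrite divcmK_le pow_sum_cmonomX // andbC.
  by case: (r <= m i)%N => //=; case: (i <= 0); rewrite ?mul1r ?mul0r.
have : pow_sum r a != 0 by apply: contraNneq pf => ->; rewrite mul0r.
rewrite /= pnatr_eq0 eqb0 negbK => /hasP[i ia /andP[_ /eqP ai]].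
by rewrite ai; apply: in_imfset => /=; rewrite -abm mdomD inE ia.
Qed.

Definition neg_supp m := forall i, 0 < i -> m i = 0%N.

Definition neg_homog d f := forall m, f m != 0 -> mdeg m = d /\ neg_supp m.

Lemma neg_homogD d f g : neg_homog d f -> neg_homog d g -> neg_homog d (f + g).
Proof.
move=> fd gd m; rewrite fcoefD; have [->|/fd//] := eqVneq (f m) 0.
by rewrite add0r; exact: gd.
Qed.

Lemma neg_homogZ d (c : rat) f : neg_homog d f -> neg_homog d (c *: f).
Proof.
move=> fd m; rewrite fcoefZ => cf; apply: fd.
by apply: contraNneq cf => ->; rewrite mulr0.
Qed.

(* Summing the hypothesis over the variables of [m] computes [f] up to the
   factor [d], since the exponents of [m] add up to [d]. *)
Lemma power_sum_expansion d f (F : nat -> fps int rat) :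
    neg_homog d f -> (forall r, (0 < r)%N -> neg_homog (d - r) (F r)) ->
    (forall m i, mdeg m = d -> neg_supp m -> i <= 0 ->
      (m i)%:R * f m =
        \sum_(1 <= r < (m i).+1) F r (divcm m (cmonomX i r))) ->
  d%:R *: f = \sum_(1 <= r < d.+1) pow_sum r * F r.
Proof.
move=> fd Fd Ff; apply/fpsP => m; rewrite fcoefZ fcoef_sum.
(* Elsewhere both sides vanish: a contributing quotient has degree [d - r] and no positive index,
   which would force [m] to satisfy both conditions. *)
have [[md m0]|nm] := pselect (mdeg m = d /\ neg_supp m); last first.
  have -> : f m = 0 by apply: contra_notP nm => /eqP/fd.
  rewrite mulr0 big_nat big1 // => r /andP[r0 rd].
  rewrite fcoef_pow_sumM // big1 // => i /andP[i0 ri].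
  apply: contra_notP nm => /eqP/(Fd _ r0)[md' m0']; split.
    by rewrite (mdeg_divcm ri) md' subnKC.
  move=> j j0; have := m0' j j0; rewrite divcmE cmonomXE.
  by case: eqP => [ij|_]; [lia | rewrite subn0].
transitivity (\sum_(1 <= r < d.+1) \sum_(i <- finsupp m | (r <= m i)%N)
    F r (divcm m (cmonomX i r))); last first.
  rewrite big_nat [RHS]big_nat; apply: eq_bigr => r /andP[r0 _].
  rewrite fcoef_pow_sumM // big_seq_cond [RHS]big_seq_cond; apply: eq_bigl => i.
  rewrite -cmE_neq0; have [//|i0] := leP i 0.
  by rewrite (m0 i i0).
rewrite -[in LHS]md mdegE natr_sum mulr_suml (exchange_big_dep xpredT) //=.
apply: eq_bigr => i _; have [i0|i0] := leP i 0; last first.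
  rewrite (m0 i i0) mul0r big_nat_cond big_pred0 // => r; lia.
(* An exponent of [m] is at most its degree [d], so the range of [r] extends to [d] with the filter
   [r <= m i]. *)
rewrite Ff // [LHS](big_nat_widen _ _ d.+1) ?ltnS -?md ?leq_mdeg //.
Qed.

(** Newton's identity $r h_r = \sum_{s=1}^r p_s h_{r-s}$ is the expansion with $F_s = h_{r-s}$; its
    term [s = r] isolates $p_r$. *)
Lemma hspan_pow_sum r : (0 < r)%N -> hspan (pow_sum r).
Proof.
have [n] := ubnP r; elim: n r => // n IH r rn r0.
have E : r%:R *: complete_sym 0 r =
    \sum_(1 <= s < r.+1) pow_sum s * complete_sym 0 (r - s).
  apply: power_sum_expansion => [|s s0|m i md m0 i0].
  - by move=> m /complete_symP.
  - by move=> m /complete_symP.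
  (* All coefficients involved are 1, so both sides count to [m i]. *)
  rewrite complete_symE // mulr1 big_nat.
  rewrite (eq_bigr (fun=> 1)) => [|s /andP[s0 sm]].
    by rewrite -big_nat big_const_nat subn1 /= -Monoid.iteropE.
  rewrite complete_symE //; first by rewrite -md (mdeg_divcm sm) addKn.
  by move=> j j0; rewrite divcmE m0.
have -> : pow_sum r = r%:R *: complete_sym 0 r -
    \sum_(1 <= s < r) pow_sum s * complete_sym 0 (r - s).
  rewrite E.
  rewrite (big_nat_recr _ _ _ r0).
  rewrite [X in _ = X - _]addrC.
  rewrite addrK.
  rewrite subnn.
  rewrite complete_sym0.
  by rewrite mulr1.
apply: spanB; first exact/spanZ/hspan_complete_sym.
rewrite big_nat; apply: span_sum => s /andP[s0 sr].
by apply: hspanM; [apply: IH => //; lia | exact: hspan_complete_sym].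
Qed.

(** * Symmetric series and the expansion of $x_t\,d/dx_t$ *)

Definition neg_sym f := forall s : int -> int, bijective s ->
  (forall i, 0 < i -> s i = i) ->
  forall m m', (forall i, m' i = m (s i)) -> f m' = f m.

Lemma neg_sym_swap f m m' t t' : neg_sym f -> t <= 0 -> t' <= 0 ->
  (forall i, m' i = m (if i == t then t' else if i == t' then t else i)) ->
  f m' = f m.
Proof.
move=> fS t0 t0'; apply: fS.
  exists (fun i => if i == t then t' else if i == t' then t else i) => i /=.
    by do ?[case: eqP => //=]; congruence.
  by do ?[case: eqP => //=]; congruence.
by move=> i i0; case: eqP => [|_]; [lia | case: eqP => //; lia].
Qed.

(** A negative index larger in absolute value than every index in the support of [m]. *)
Definition fresh m : int := - (\sum_(i <- finsupp m) `|i|).+1%N%:Z.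

Lemma fresh_le0 m : fresh m <= 0. Proof. by rewrite /fresh; lia. Qed.

Lemma freshP m : m (fresh m) = 0%N.
Proof.
apply/eqP; rewrite cmE_eq0; apply/negP => fm.
have : (`|fresh m| <= \sum_(i <- finsupp m) `|i|)%N.
  by rewrite (big_fsetD1 (fresh m)) //= leq_addr.
by rewrite {1}/fresh; lia.
Qed.

(* For symmetric [f] this is the coefficient of [x_t^n] in [f], with the other
   variables renamed to fill the gap at [t]. *)
Definition var_coef n f : fps int rat :=
  Fps (fun m => f (mmul m (cmonomX (fresh m) n))).

(** The transposition of [t] and [fresh m] fixes [m], as both exponents are 0, so the choice of the
    empty slot is immaterial. *)
Lemma var_coefE n f m t : neg_sym f -> t <= 0 -> m t = 0%N ->
  var_coef n f m = f (mmul m (cmonomX t n)).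
Proof.
move=> fS t0 mt; apply: (neg_sym_swap fS (fresh_le0 m) t0) => i.
rewrite !cmM !cmonomXE; have mf := freshP m.
have [->|it] := eqVneq i (fresh m); first by rewrite eqxx mf mt.
have [E|it'] := eqVneq i t.
  by rewrite -E mf (negPf it) E mt.
by rewrite [t == i]eq_sym (negPf it').
Qed.

Lemma var_coef_homog n d f : neg_homog d f -> neg_homog (d - n) (var_coef n f).
Proof.
move=> fd m /= /fd[]; rewrite mdegM mdeg_cmonomX => <- m0; split.
  by rewrite addnK.
by move=> i /m0/eqP; rewrite cmM addn_eq0 => /andP[/eqP].
Qed.

Lemma var_coef_sym n f : neg_sym f -> neg_sym (var_coef n f).
Proof.
move=> fS s sbij s0 m m' mm'; have [s' sK s'K] := sbij.
(* [s] need not preserve fresh indices, but it sends this one to an empty nonpositive slot of [m],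
   which is enough for [var_coefE]. *)
have sf : s (fresh m') <= 0.
  rewrite leNgt; apply/negP => h; have := bij_inj sbij (s0 _ h).
  by have := fresh_le0 m'; lia.
have msf : m (s (fresh m')) = 0%N by rewrite -mm' freshP.
rewrite (var_coefE n fS sf msf) /=; apply: (fS s) => // i.
rewrite !cmM !cmonomXE mm'; congr (_ + (if _ then _ else _))%N.
by rewrite (inj_eq (bij_inj sbij)).
Qed.

(* The coefficient of [m x_t^a] in [x_t df/dx_t] is [a] times that in [f], and
   [F r] is built so that [x_t df/dx_t = \sum_(r > 0) x_t^r F r] for all [t]. *)
Lemma exists_expansion d f N : neg_homog d f -> neg_sym f ->
  exists F : nat -> fps int rat,
    (forall r, (0 < r)%N -> neg_homog (d - r) (F r) /\ neg_sym (F r)) /\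
    (forall a m t, (0 < a <= N)%N -> t <= 0 -> m t = 0%N ->
      a%:R * f (mmul m (cmonomX t a)) =
        \sum_(1 <= r < a.+1) F r (mmul m (cmonomX t (a - r)%N))).
Proof.
move=> fd fS; elim: N => [|N [F [FS FE]]].
  exists (fun=> 0); split=> [r _|a m t]; last by case: a.
  by split=> [m|s _ _ m m' _]; rewrite fcoef0 // eqxx.
(* The equation for [a = N.+1] forces this choice: its last summand is the new series at [m] itself,
   and the earlier ones are coefficients of $x_t^{N+1-s}$ in [F s]. *)
pose G := N.+1%:R *: var_coef N.+1 f -
  \sum_(1 <= s < N.+1) var_coef (N.+1 - s)%N (F s).
have GE m : G m = N.+1%:R * var_coef N.+1 f m -
    \sum_(1 <= s < N.+1) var_coef (N.+1 - s)%N (F s) m.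
  by rewrite -fcoef_sum.
have Gd : neg_homog (d - N.+1) G.
  apply: neg_homogD; first exact/neg_homogZ/var_coef_homog.
  rewrite -scaleN1r; apply: neg_homogZ; rewrite big_nat.
  elim/big_rec: _ => [m|s g /andP[s0 sN] gd]; first by rewrite fcoef0 eqxx.
  apply: neg_homogD => //; have -> : (d - N.+1 = d - s - (N.+1 - s))%N by lia.
  by apply: var_coef_homog; case: (FS s s0).
have GS : neg_sym G.
  move=> s sbij s0 m m' mm'; rewrite !GE (var_coef_sym _ fS sbij s0 mm').
  congr (_ - _); rewrite big_nat [RHS]big_nat; apply: eq_bigr => r /andP[r0 _].
  by case: (FS r r0) => _ FrS; exact: (var_coef_sym _ FrS sbij s0 mm').
exists (fun r => if r == N.+1 then G else F r).
split=> [r r0|a m t /andP[a0]]; first by case: eqP => [->|_]; [split | exact: FS].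
rewrite leq_eqVlt ltnS => /predU1P[->|aN] t0 mt; last first.
  rewrite FE ?a0 // big_nat [RHS]big_nat; apply: eq_bigr => r /andP[_ ra].
  by case: eqP => // rN; lia.
rewrite big_nat_recr //= eqxx subnn.
have -> : mmul m (cmonomX t 0) = m.
  by apply/eqP/cmP => i; rewrite cmM cmonomXE if_same addn0.
rewrite GE (var_coefE _ fS t0 mt) addrC -addrA [X in _ + X](_ : _ = 0) ?addr0 //.
apply/eqP; rewrite addrC subr_eq0; apply/eqP.
rewrite big_nat [RHS]big_nat; apply: eq_bigr => r /andP[r0 rN].
case: eqP => [|_]; first lia.
by case: (FS r r0) => _ FrS; rewrite (var_coefE _ FrS t0 mt).
Qed.

Lemma hspan_neg_sym d f : neg_homog d f -> neg_sym f -> hspan f.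
Proof.
have [n] := ubnP d; elim: n d f => // n IH [|d] f dn fd fS.
  have -> : f = f mone *: 1; last exact/spanZ/hspan1.
  apply/fpsP => m; rewrite fcoefZ fcoef1.
  have [->|m1] := eqVneq m mone; first by rewrite mulr1.
  rewrite mulr0; apply: contra_neq_eq m1 => /fd[/eqP].
  by rewrite mdeg_eq0 => /eqP.
have [F [FS FE]] := exists_expansion d.+1 fd fS.
have E : d.+1%:R *: f = \sum_(1 <= r < d.+2) pow_sum r * F r.
  apply: power_sum_expansion => // [r /FS[]//|m i md m0 i0].
  have [mi|mi] := posnP (m i); first by rewrite mi mul0r big_geq.
  (* Removing $x_i$ from [m] entirely supplies the empty slot that the expansion needs at
     [t = i]. *)
  pose u := divcm m (cmonomX i (m i)).
  have mu : m = mmul u (cmonomX i (m i)) by rewrite mulmC divcmK.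
  rewrite {2}mu FE ?mi -?md ?leq_mdeg //; last first.
    by rewrite divcmE cmonomXE eqxx subnn.
  rewrite big_nat [RHS]big_nat; apply: eq_bigr => r /andP[_ rm]; congr (F r _).
  apply/eqP/cmP => j; rewrite cmM !divcmE !cmonomXE.
  by case: eqP => [<-|_]; lia.
have -> : f = d.+1%:R^-1 *: (d.+1%:R *: f).
  by rewrite scalerA mulVf ?scale1r // pnatr_eq0.
apply: spanZ; rewrite E big_nat; apply: span_sum => r /andP[r0 rd].
case: (FS r r0) => Frd FrS; apply: hspanM; first exact: hspan_pow_sum.
by apply: IH Frd FrS; lia.
Qed.

(** * Relabelling variables and products of symmetric functions *)

Section Relabel.
Context (s s' : int -> int) (sK : cancel s s') (s'K : cancel s' s).

Definition relabel m : {cmonom int} :=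
  [cmonom m (s i) | i in [fset s' j | j in finsupp m]]%M.

Lemma relabelE m i : relabel m i = m (s i).
Proof.
rewrite cmE fsfun_fun; case: ifP => // /negP nmi.
apply/eqP; rewrite eq_sym cmE_eq0; apply/negP => msi; apply: nmi.
by rewrite -[i]sK; apply: in_imfset.
Qed.

End Relabel.

Lemma mdeg_relabel (s : int -> int) m m' : bijective s ->
  (forall i, m' i = m (s i)) -> mdeg m' = mdeg m.
Proof.
case=> s' sK s'K mm'.
rewrite (@mdegEw _ m [fset s i | i in finsupp m']%fset).
  rewrite big_imfset => [|i j _ _ /=]; last exact: can_inj sK i j.
  by rewrite mdegE; apply: eq_bigr => i _; exact: mm'.
apply/fsubsetP => j mj; rewrite -[j]s'K; apply: in_imfset => /=.
by rewrite -cmE_neq0 mm' s'K cmE_neq0.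
Qed.

(** Bounded degree leaves finitely many homogeneous components, and each is symmetric because
    relabelling preserves degree. *)
Lemma hspan_Lambda f : Lambda_minus f -> hspan f.
Proof.
case=> -[n fn] f0 fS.
pose hom d : fps int rat := Fps (fun m => if mdeg m == d then f m else 0).
have -> : f = \sum_(0 <= d < n.+1) hom d.
  apply/fpsP => m; rewrite fcoef_sum /=.
  have [->|fm] := eqVneq (f m) 0; first by rewrite big1 // => d _; rewrite if_same.
  rewrite (bigD1_seq (mdeg m)) ?mem_index_iota ?ltnS ?fn ?iota_uniq //= eqxx.
  by rewrite big1 ?addr0 // => d; rewrite eq_sym => /negPf->.
apply: span_sum => d _; apply: (@hspan_neg_sym d) => [m|s sbij s0 m m' mm'] /=.
  by case: (mdeg m =P d) => [md fm|_]; [split=> // i; exact: f0 | rewrite eqxx].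
by rewrite (mdeg_relabel sbij mm') (fS s sbij s0 m m').
Qed.

(** For the symmetry, relabelling is a bijection on monomials compatible with products and
    quotients, so it matches the factorizations of [m] with those of its image. *)
Lemma LambdaM f g : Lambda_minus f -> Lambda_minus g -> Lambda_minus (f * g).
Proof.
move=> [[p fp] f0 fS] [[q gq] g0 gS]; split.
- exists (p + q)%N => m /fcoefM_neq0[a [b [<- /fp ap /gq bq]]].
  by rewrite mdegM leq_add.
- move=> m /fcoefM_neq0[a [b [<- /f0 a0 /g0 b0]]] i i0.
  by rewrite cmM a0 // b0.
move=> s sbij s0 m m' mm'; have [s' sK s'K] := sbij.
pose rho := relabel s s'; have rhoE := relabelE sK.
have rhoK : cancel rho (relabel s' s).
  by move=> a; apply/eqP/cmP => i; rewrite (relabelE s'K) rhoE s'K.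
have rhoK' : cancel (relabel s' s) rho.
  by move=> a; apply/eqP/cmP => i; rewrite rhoE (relabelE s'K) sK.
have rhoM a b : rho (mmul a b) = mmul (rho a) (rho b).
  by apply/eqP/cmP => i; rewrite cmM !rhoE cmM.
have rhoD a b : rho (divcm a b) = divcm (rho a) (rho b).
  by apply/eqP/cmP => i; rewrite divcmE !rhoE divcmE.
have -> : m' = rho m by apply/eqP/cmP => i; rewrite rhoE.
have [D mD] := divisors_finite m.
rewrite (@fcoefM _ _ _ _ _ [fset rho a | a in D]%fset) => [|a b ab _]; last first.
  rewrite -[a]rhoK'; apply: in_imfset => /=; apply: (mD _ (relabel s' s b)).
  by apply: (can_inj rhoK); rewrite rhoM !rhoK'.
rewrite (@fcoefM _ _ _ _ m D) => [|a b ab _]; last exact: mD ab.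
rewrite big_mkcond big_imfset => [|a b _ _]; last exact: can_inj rhoK a b.
rewrite [RHS]big_mkcond; apply: eq_bigr => a _.
rewrite -rhoD -rhoM (inj_eq (can_inj rhoK)).
by rewrite (fS s sbij s0 a) // (gS s sbij s0 (divcm m a)).
Qed.

Lemma Lambda_complete_sym d : Lambda_minus (complete_sym 0 d).
Proof.
split=> [|m /complete_symP[]//|s sbij s0 m m' mm'].
  by exists d => m /complete_symP[->].
have fsE i : 0 < i -> (i \in finsupp m') = (i \in finsupp m).
  by move=> i0; rewrite -!cmE_neq0 mm' s0.
rewrite /= (mdeg_relabel sbij mm'); congr ((_ && _)%:R).
apply/allP/allP => le i mi; have [//|i0] := leP i 0; move: mi.
  by rewrite -fsE // => /le; rewrite leNgt i0.
by rewrite fsE // => /le; rewrite leNgt i0.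
Qed.

(** * The back stable ring *)

(** Restricting the polynomial factor to one monomial makes generators multiply to generators, which
    gives closure under products directly. *)
Definition tensor_span :=
  span [set h | exists2 g, Lambda_minus g & exists m, h = g * fps_monom rat m].

Lemma tensor_spanM f g : tensor_span f -> tensor_span g -> tensor_span (f * g).
Proof.
apply: spanM => _ _ [a aL [u ->]] [b bL [v ->]]; apply: span_mem.
exists (a * b); first exact: LambdaM.
by exists (mmul u v); rewrite fps_monomM mulrACA.
Qed.

(** At [k = 0] the series is symmetric. The recursion then moves the index up or down, at the cost
    of $x_k$ times a series of smaller degree. *)
Lemma tensor_span_complete_sym k d : tensor_span (complete_sym k d).
Proof.
have L0 n : tensor_span (complete_sym 0 n).
  apply: span_mem; exists (complete_sym 0 n); first exact: Lambda_complete_sym.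
  by exists mone; rewrite fps_monom1 mulr1.
have X0 i : tensor_span (X_ i).
  apply: span_mem; exists (complete_sym 0 0); first exact: Lambda_complete_sym.
  by exists (cmonomX i 1); rewrite complete_sym0 mul1r.
elim: d k => [|d IH] k; first by rewrite complete_sym0 -(complete_sym0 0).
elim/int_rect: k => [|n kn|n kn] //.
  rewrite complete_symS; apply: spanD; last exact: tensor_spanM.
  by rewrite (_ : n.+1%:Z - 1 = n) //; lia.
have -> : complete_sym (- n.+1%:Z) d.+1 =
    complete_sym (- n%:Z) d.+1 - X_ (- n%:Z) * complete_sym (- n%:Z) d.
  rewrite (complete_symS (- n%:Z)) (_ : - n%:Z - 1 = - n.+1%:Z) ?addrK //; lia.
by apply: spanB => //; exact: tensor_spanM.
Qed.

Lemma tensor_span_backstable f : tensor_span f -> backstable_ring f.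
Proof.
elim=> [|a _ w [g gL [m ->]] _ [n [h [p [hL ->]]]]].
  exists 0%N, (fun=> 0), (fun=> 0); split; first by case.
  by rewrite big_ord0.
(* The new generator takes position 0, with its scalar absorbed into the polynomial; the old terms
   shift by one. *)
exists n.+1, (fun j : 'I_n.+1 => oapp h g (unlift ord0 j)),
  (fun j : 'I_n.+1 => oapp p (a *: << m >>) (unlift ord0 j)).
split=> [j|]; first by case: (unlift ord0 j) => /=.
rewrite big_ord_recl unlift_none /=; congr (_ + _).
  rewrite scalerAr; congr (_ * _); apply/fpsP => u.
  by rewrite /= mcoeffZ mcoeffU1 eq_sym.
by apply: eq_bigr => j _; rewrite liftK.
Qed.

Lemma hspan_backstable f : backstable_ring f -> hspan f.
Proof.
case=> n [g [p [gL ->]]]; apply: span_sum => j _; apply: hspanM.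
  exact: hspan_Lambda.
rewrite fps_of_polyE; apply: span_sum => m _.
exact/spanZ/hspan_monom.
Qed.

Theorem corollary4p5 :
  @family_basis rat (fps int rat) compositions backstable_ring backstable_h.
Proof.
split=> [alpha|F c|v /hspan_backstable]; last exact: span_range_fset.
  apply: tensor_span_backstable; rewrite /backstable_h.
  elim/big_rec: _ => [|i f _ IH].
    by rewrite -(complete_sym0 0); exact: tensor_span_complete_sym.
  by apply: tensor_spanM => //; exact: tensor_span_complete_sym.
exact: backstable_h_free.
Qed.
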